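(* Given $\psi\in L^1([-M,M])$ and $i\neq j$, one has, for all $\epsilon>0$ and $y\in[-M,M]$, $$\left|J^\psi_{j\to i}(y)\right|\le O(1)\,\|\psi\|_{L^1}\,\big(\varphi_j^\star(y)+\varphi_i^\star(y)\big),$$ where $$J^\psi_{j\to i}(y):=\varphi_i^\star(y)\int_{c_i}^{y}\psi(x)\,\frac{\varphi_j^\star(x)}{\varphi_i^\star(x)}\,dx$$ and $O(1)$ denotes a constant independent of $\epsilon$, $y$ and $\psi$.
   Context: Let $\mathcal{B}(\delta_0)\subset\mathbb{R}^N$ be the ball of small radius $\delta_0$ centered at $0$. Let $A_0,A_1,B_0$ be smooth $N\times N$ matrix fields on $\mathcal{B}(\delta_0)\times[-1,1]$, with $A_0$ invertible and $B_0$ non-degenerate, and set $A:=A_1A_0^{-1}$, $B:=B_0A_0^{-1}$. The matrix $A(u,v)$ has real distinct eigenvalues $\lambda_1(u,v)<\dots<\lambda_N(u,v)$, with left/right eigenvectors $l_i,r_i$ normalized by $l_i\cdot r_j=\delta_{ij}$. The wave speeds are uniformly separated: there are constants $$-M<\underline\Lambda_1<\overline\Lambda_1<\underline\Lambda_2<\dots<\underline\Lambda_N<\overline\Lambda_N<M,\qquad \underline\Lambda_i=\lambda_i(0,0)-O(\delta_0),\quad\overline\Lambda_i=\lambda_i(0,0)+O(\delta_0),$$ with $\underline\Lambda_i\le\lambda_i(u,v)\le\overline\Lambda_i$ for $u\in\mathcal{B}(\delta_0)$, $v\in[-1,1]$. Moreover $l_i(u_1,v)\cdot r_i(u_2,v)\ge1-\delta_0$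 and $|l_i(u_1,v)\cdot r_j(u_2,v)|\le\delta_0$ for $i\ne j$, $u_1,u_2\in\mathcal{B}(\delta_0)$, $v\in[-1,1]$. It is assumed that $\sup|B(u,v)-I|\le\eta$ for a sufficiently small $\eta>0$, and that $\delta_0$ is sufficiently small. Generalized eigenvalue problem: $\hat r_i(u,v,\xi),\hat l_i(u,v,\xi)\in\mathbb{R}^N$ and $\mu_i(u,v,\xi)\in\mathbb{R}$ satisfy $$(-\xi I+A)\hat r_i=\mu_iB\hat r_i,\qquad \hat l_i\cdot(-\xi I+A)=\mu_i\,\hat l_i\cdot B,$$ with $\hat r_i\cdot\hat r_i=1$, $\hat l_i\cdot B\hat r_j=\delta_{ij}$. Then $\mu_i=(-\xi+\hat\lambda_i)d_i$, where $\hat\lambda_i:=\hat r_i\cdot A\hat r_i$ and $1/d_i:=\hat r_i\cdot B\hat r_i$, and $\underline\Lambda_i-O(\eta)\le\hat\lambda_i\le\overline\Lambda_i+O(\eta)$, $1-O(\eta)\le d_i\le1+O(\eta)$ for $\xi\in[-M,M]$. Given $\epsilon>0$ and continuous functions $u:[-M,M]\to\mathcal{B}(\delta_0)$, $v:[-M,M]\to[-1,1]$, define the linearized wave measures $$\varphi_i^\star:=\frac{e^{-g_i/\epsilon}}{\int_{-M}^{M}e^{-g_i/\epsilon}\,dy},\qquad g_i(y):=-\int_{\rho_i}^{y}\mu_i(u(x),v(x),x)\,dx,$$ where $\rho_i$ is chosen so that $g_i\ge0$ (the function $\varphi_i^\star$ does not depend on this choice). The points $c_i\in[\underline\Lambda_i,\overline\Lambda_i]$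 are fixed independently of $\epsilon$. *)

(* Defs.v *)
From HB Require Import structures.
From mathcomp Require Import all_boot all_order all_algebra.
From mathcomp Require Import all_classical all_reals all_analysis.

Set Implicit Arguments.
Unset Strict Implicit.
Unset Printing Implicit Defensive.

Import Order.TTheory GRing.Theory Num.Theory.
Import numFieldNormedType.Exports.

Local Open Scope classical_set_scope.
Local Open Scope ring_scope.

Section Smooth.
Context {R : realType}.

(* The iterated directional derivative D_{h_1} ... D_{h_k} f, s = [h_1; ...; h_k]. *)
Definition iter_derive (V : normedModType R) (s : seq V) (f : V -> R) : V -> R :=
  foldr (fun (h : V) (g : V -> R) => ('D_h g : V -> R)) f s.

(* C^oo on U, meant for U open: iterated directional derivatives of every
   order exist and are continuous. *)
Definition smooth_open (V : normedModType R) (U : set V) (f : V -> R) : Prop :=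
  forall (s : seq V) (p : V), U p ->
    {for p, continuous (iter_derive s f)} /\
    (forall h : V, derivable (iter_derive s f) p h).

(* D need not be open: f is smooth on D when it has a smooth extension to an
   open neighbourhood of D. *)
Definition smooth_on (V : normedModType R) (D : set V) (f : V -> R) : Prop :=
  exists (U : set V) (g : V -> R),
    [/\ open U, D `<=` U, smooth_open U g & forall p, D p -> f p = g p].

End Smooth.

Section Setting.
Context {R : realType} {N : nat}.

Definition matrix_field := 'cV[R]_N -> R -> 'M[R]_N.

Definition dot (x y : 'cV[R]_N) : R := \sum_(k < N) x k 0 * y k 0.

(* Euclidean ball; the norm of the library on 'cV[R]_N is the sup norm. *)
Definition state_ball (delta0 : R) : set 'cV[R]_N :=
  [set u | Num.sqrt (dot u u) < delta0].

Definition domain (delta0 : R) : set ('cV[R]_N * R) :=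
  [set p | state_ball delta0 p.1 /\ -1 <= p.2 <= 1].

Definition smooth_field (delta0 : R) (F : matrix_field) : Prop :=
  forall a b : 'I_N,
    smooth_on (domain delta0) (fun p : 'cV[R]_N * R => F p.1 p.2 a b).

(* F A0^-1: gives A for F = A1 and B for F = B0. *)
Definition normalized (A0 F : matrix_field) : matrix_field :=
  fun u v => F u v *m invmx (A0 u v).

(* The hypotheses on A0, A1, B0, on A = A1 A0^-1 with its eigenvalues lam and
   eigenvectors l, r, and on the wave-speed bounds Lamlo, Lamhi.  The number K
   is the implied constant in Lamlo_i, Lamhi_i = lambda_i(0,0) -/+ O(delta0),
   and lam0_i is the value lambda_i(0,0). *)
Record hyperbolic_system (M K delta0 : R) (lam0 : 'I_N -> R)
    (A0 A1 B0 : matrix_field) (lam : 'I_N -> 'cV[R]_N -> R -> R)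
    (l r : 'I_N -> 'cV[R]_N -> R -> 'cV[R]_N) (Lamlo Lamhi : 'I_N -> R) : Prop :=
  HyperbolicSystem {
    hs_smoothA0 : smooth_field delta0 A0 ;
    hs_smoothA1 : smooth_field delta0 A1 ;
    hs_smoothB0 : smooth_field delta0 B0 ;
    hs_unitA0 : forall u v, domain delta0 (u, v) -> A0 u v \in unitmx ;
    hs_unitB0 : forall u v, domain delta0 (u, v) -> B0 u v \in unitmx ;
    hs_right : forall u v, domain delta0 (u, v) -> forall i,
      normalized A0 A1 u v *m r i u v = lam i u v *: r i u v ;
    hs_left : forall u v, domain delta0 (u, v) -> forall i,
      (l i u v)^T *m normalized A0 A1 u v = lam i u v *: (l i u v)^T ;
    hs_distinct : forall u v, domain delta0 (u, v) -> forall i j : 'I_N,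
      (i < j)%N -> lam i u v < lam j u v ;
    hs_dual : forall u v, domain delta0 (u, v) -> forall i j,
      dot (l i u v) (r j u v) = (i == j)%:R ;
    hs_lam0 : forall i, lam i 0 0 = lam0 i ;
    hs_range : forall i, [/\ - M < Lamlo i, Lamlo i < Lamhi i & Lamhi i < M] ;
    hs_separated : forall i j : 'I_N, (i < j)%N -> Lamhi i < Lamlo j ;
    hs_width : forall i,
      `|Lamlo i - lam0 i| <= K * delta0 /\ `|Lamhi i - lam0 i| <= K * delta0 ;
    hs_bounds : forall u v, domain delta0 (u, v) -> forall i,
      Lamlo i <= lam i u v <= Lamhi i ;
    hs_diag : forall u1 u2 v, domain delta0 (u1, v) -> domain delta0 (u2, v) ->
      forall i, dot (l i u1 v) (r i u2 v) >= 1 - delta0 ;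
    hs_offdiag : forall u1 u2 v, domain delta0 (u1, v) -> domain delta0 (u2, v) ->
      forall i j, i != j -> `|dot (l i u1 v) (r j u2 v)| <= delta0
  }.

(* The generalized eigenvalue problem, with B within eta of I in the entrywise
   sup norm.  The last clause is
   Lamlo_i - O(eta) <= rhat_i . A rhat_i <= Lamhi_i + O(eta)
   with implied constant K; the eigenvalue relations alone do not determine
   which index i a given eigenvalue carries, this clause does.
   mu_i = (- xi + rhat_i . A rhat_i) d_i and d_i = 1 + O(eta) are not assumed. *)
Record generalized_eigensystem (M K delta0 eta : R)
    (A0 A1 B0 : matrix_field) (Lamlo Lamhi : 'I_N -> R)
    (mu : 'I_N -> 'cV[R]_N -> R -> R -> R)
    (lhat rhat : 'I_N -> 'cV[R]_N -> R -> R -> 'cV[R]_N) : Prop :=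
  GeneralizedEigensystem {
    ge_near_id : forall u v, domain delta0 (u, v) ->
      `|normalized A0 B0 u v - 1%:M| <= eta ;
    ge_right : forall u v xi, domain delta0 (u, v) -> - M <= xi <= M ->
      forall i, (- xi%:M + normalized A0 A1 u v) *m rhat i u v xi =
                mu i u v xi *: (normalized A0 B0 u v *m rhat i u v xi) ;
    ge_left : forall u v xi, domain delta0 (u, v) -> - M <= xi <= M ->
      forall i, (lhat i u v xi)^T *m (- xi%:M + normalized A0 A1 u v) =
                mu i u v xi *: ((lhat i u v xi)^T *m normalized A0 B0 u v) ;
    ge_unit : forall u v xi, domain delta0 (u, v) -> - M <= xi <= M ->
      forall i, dot (rhat i u v xi) (rhat i u v xi) = 1 ;
    ge_dual : forall u v xi, domain delta0 (u, v) -> - M <= xi <= M ->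
      forall i j, dot (lhat i u v xi) (normalized A0 B0 u v *m rhat j u v xi) =
                  (i == j)%:R ;
    ge_lamhat : forall u v xi, domain delta0 (u, v) -> - M <= xi <= M ->
      forall i,
        Lamlo i - K * eta
          <= dot (rhat i u v xi) (normalized A0 A1 u v *m rhat i u v xi)
          <= Lamhi i + K * eta
  }.

End Setting.

Section WaveMeasures.
Context {R : realType} {N : nat}.

(* The oriented integral of f from a to b, for a and b in any order. *)
Definition oriented_integral (a b : R) (f : R -> R) : R :=
  if a <= b then \int[lebesgue_measure]_(x in `[a, b]) f x
  else - \int[lebesgue_measure]_(x in `[b, a]) f x.

Definition phase (mu : 'I_N -> 'cV[R]_N -> R -> R -> R)
    (u : R -> 'cV[R]_N) (v : R -> R) (rho : 'I_N -> R) (i : 'I_N) (y : R) : R :=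
  - oriented_integral (rho i) y (fun x => mu i (u x) (v x) x).

Definition phistar (M eps : R) (mu : 'I_N -> 'cV[R]_N -> R -> R -> R)
    (u : R -> 'cV[R]_N) (v : R -> R) (rho : 'I_N -> R) (i : 'I_N) (y : R) : R :=
  expR (- phase mu u v rho i y / eps) /
  \int[lebesgue_measure]_(x in `[- M, M]) expR (- phase mu u v rho i x / eps).

Definition interaction (M eps : R) (mu : 'I_N -> 'cV[R]_N -> R -> R -> R)
    (u : R -> 'cV[R]_N) (v : R -> R) (rho c : 'I_N -> R) (psi : R -> R)
    (j i : 'I_N) (y : R) : R :=
  let phi := phistar M eps mu u v rho in
  phi i y * oriented_integral (c i) y (fun x => psi x * (phi j x / phi i x)).

Definition L1norm (M : R) (psi : R -> R) : R :=
  \int[lebesgue_measure]_(x in `[- M, M]) `|psi x|.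

End WaveMeasures.

(* Main.v *)
Require Import Defs.
From HB Require Import structures.
From mathcomp Require Import all_boot all_order all_algebra.
From mathcomp Require Import all_classical all_reals all_analysis.
From mathcomp Require Import measurable_realfun.
From mathcomp Require Import ring lra.

(** Write m_k(x) = mu_k(u(x), v(x), x), so that the phase g_k decreases at the
rate m_k, and the measure phi_k is exp(- g_k / eps) divided by its integral Z_k.

The whole estimate rests on one approximation, [eigenvalue_near]: the
generalized eigenvalue is a Rayleigh quotient whose denominator is 1 + O(eta),
so m_k(x) = lam0_k - x up to an error tau.  Here tau > 0 is fixed so that the speeds
lam0_k are at least 16 tau apart, and delta_bar and eta_bar are small enough for
the error to be at most tau.  Two consequences follow for i <> j.

First, m_i - m_j has a constant sign, so the ratio
w = phi_j / phi_i = exp((g_i - g_j) / eps) Z_i / Z_j is monotone, whichever of the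
two speeds is larger.  Between c_i and y it is therefore at most w(c_i) + w(y),
and the integral of psi w from c_i to y is at most that times the L1 norm of psi.
Multiplied by phi_i(y), the term w(y) gives exactly phi_j(y).

Second, w(c_i) is bounded uniformly in eps.  The minimum of g_i is near lam0_i,
so g_i(c_i) <= 4 tau^2 ([phase_center_le]), whereas c_i is far from lam0_j and
g_j(c_i) >= 49 tau^2 ([phase_far_ge]).  Hence the exponential in w(c_i) is at
most exp(- 45 tau^2 / eps).  The ratio Z_i / Z_j costs only O(1 + 1 / eps), since
Z_i <= 2 M and g_j is Lipschitz and vanishes somewhere, and the exponential
absorbs this factor ([gibbs_ratio_le]).

All this needs the phases to be genuine primitives, hence m_k to be integrable,
whereas mu_k is given only pointwise, through the eigenvalue problem.  Its
continuity along (u, v) is [eigenvalue_continuous]: det (A1 - x A0 - t B0) equals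
det B0 prod_k (m_k(x) - t), which for each t is continuous in x, and the m_k are
the roots of this polynomial in t, simple and listed in increasing order, so
sign changes of the polynomial locate each of them. *)

Set Implicit Arguments.
Unset Strict Implicit.
Unset Printing Implicit Defensive.

Import Order.TTheory GRing.Theory Num.Theory.
Import numFieldNormedType.Exports.
Local Open Scope classical_set_scope.
Local Open Scope ring_scope.

(** * Oriented integrals and functions with a prescribed rate of decrease *)

Section Increments.
Context {R : realType}.
Notation mu := (@lebesgue_measure R).
Implicit Types (a b c x y M k : R) (f m g w psi : R -> R).

Lemma Rintegral_itv_cat f a b c : a <= b -> b <= c ->
  mu.-integrable `[a, c] (EFin \o f) ->
  \int[mu]_(x in `[a, c]) f x =
  \int[mu]_(x in `[a, b]) f x + \int[mu]_(x in `[b, c]) f x.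
Proof.
move=> ab bc fi; have := @Rintegral_itvB R f (BLeft a) (BRight c) b fi.
rewrite !bnd_simp => /(_ ab bc) e.
rewrite -[X in _ + X]Rintegral_itv_obnd_cbnd; first by rewrite -e addrC subrK.
apply: integrableS fi => //; apply: subset_itv; by rewrite bnd_simp.
Qed.

Lemma oriented_integralB f M a x y : mu.-integrable `[- M, M] (EFin \o f) ->
  - M <= a <= M -> - M <= x -> x <= y -> y <= M ->
  oriented_integral a y f - oriented_integral a x f =
  \int[mu]_(t in `[x, y]) f t.
Proof.
move=> fi /andP[Ma aM] Mx xy yM.
have sub b c : - M <= b -> c <= M -> mu.-integrable `[b, c] (EFin \o f).
  move=> ? ?; apply: integrableS fi => //; apply: subset_itv; by rewrite bnd_simp.
rewrite /oriented_integral.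
case: (leP a x) => ax; case: (leP a y) => ay; last 1 first.
- by rewrite (@Rintegral_itv_cat f x y a) ?(ltW ay)//; [ring|exact: sub].
- by rewrite (@Rintegral_itv_cat f a x y)//; [ring|exact: sub].
- by move: (le_lt_trans xy ay); rewrite ltNge ax.
- by rewrite (@Rintegral_itv_cat f x a y) ?(ltW ax)//; [ring|exact: sub].
Qed.

Lemma Rintegral_itv_cst x y k : x <= y ->
  \int[mu]_(t in `[x, y]) k = k * (y - x).
Proof.
move=> xy; rewrite Rintegral_cst//; congr (_ * _).
rewrite /= lebesgue_measure_itv/= lte_fin; move: xy.
by rewrite le_eqVlt => /predU1P[->|->]; rewrite ?ltxx ?subrr.
Qed.

Lemma within_continuous_integrable f M : {within `[- M, M], continuous f} ->
  mu.-integrable `[- M, M] (EFin \o f).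
Proof.
move=> fc; apply: (@continuous_compact_integrable R f); last exact: fc.
exact: segment_compact.
Qed.

Lemma integrable_cst_itv k x y : mu.-integrable `[x, y] (EFin \o (fun=> k)).
Proof.
apply: (@continuous_compact_integrable R (fun=> k)); first exact: segment_compact.
by apply: continuous_subspaceT => z; exact: cst_continuous.
Qed.

(** The integrated form of g' = - m: rates are compared by monotonicity of the
integral, without differentiating the phases. *)
Definition decreases_at_rate M m g := forall x y,
  - M <= x -> x <= y -> y <= M -> g x - g y = \int[mu]_(t in `[x, y]) m t.

Section Rate.
Context (M : R) (m g : R -> R) (mi : mu.-integrable `[- M, M] (EFin \o m))
  (gm : decreases_at_rate M m g).

Let mi_sub x y : - M <= x -> y <= M -> mu.-integrable `[x, y] (EFin \o m).
Proof.
by move=> Mx yM; apply: integrableS mi => //; apply: subset_itv; rewrite bnd_simp.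
Qed.

Lemma drop_le k x y : - M <= x -> x <= y -> y <= M ->
  (forall t, x <= t <= y -> m t <= k) -> g x - g y <= k * (y - x).
Proof.
move=> Mx xy yM mk; rewrite gm// -Rintegral_itv_cst//.
apply: le_Rintegral => //; first [exact: mi_sub|exact: integrable_cst_itv].
Qed.

Lemma drop_ge k x y : - M <= x -> x <= y -> y <= M ->
  (forall t, x <= t <= y -> k <= m t) -> k * (y - x) <= g x - g y.
Proof.
move=> Mx xy yM mk; rewrite gm// -Rintegral_itv_cst//.
apply: le_Rintegral => //; first [exact: mi_sub|exact: integrable_cst_itv].
Qed.

Lemma rate_lipschitz k x y :
  (forall t, - M <= t <= M -> `|m t| <= k) ->
  - M <= x <= M -> - M <= y <= M -> `|g x - g y| <= k * `|x - y|.
Proof.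
move=> mk; wlog xy : x y / x <= y => [H|] /andP[Mx xM] /andP[My yM].
  case: (leP x y) => [xy|/ltW yx]; first by apply: H; rewrite ?Mx ?My.
  by rewrite distrC (distrC x); apply: H; rewrite ?Mx ?My.
rewrite (distrC x) (ger0_norm (_ : 0 <= y - x)) ?subr_ge0//.
have mk' t : x <= t <= y -> - k <= m t <= k.
  by move=> /andP[xt ty]; rewrite -ler_norml mk// (le_trans Mx)// (le_trans ty).
rewrite ler_norml -mulNr drop_le ?drop_ge// => t /mk' /andP[]//.
Qed.

End Rate.

Lemma Rintegral_subitv_le f M a b : mu.-integrable `[- M, M] (EFin \o f) ->
  - M <= a -> b <= M -> (forall x, - M <= x <= M -> 0 <= f x) ->
  \int[mu]_(x in `[a, b]) f x <= \int[mu]_(x in `[- M, M]) f x.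
Proof.
move=> fi Ma bM f0.
have sub : `[a, b]%classic `<=` `[- M, M]%classic.
  by apply: subset_itv; rewrite bnd_simp.
rewrite /Rintegral fine_le//.
- by apply: integrable_fin_num => //; exact: integrableS fi.
- exact: integrable_fin_num.
- apply: ge0_subset_integral => //; exact: (measurable_int mu fi).
Qed.

Lemma lipschitz_within_continuous k M g :
  (forall x y, - M <= x <= M -> - M <= y <= M -> `|g x - g y| <= k * `|x - y|) ->
  {within `[- M, M], continuous g}.
Proof.
move=> gk; apply/subspace_continuousP => x /=; rewrite in_itv/= => xM.
apply/cvgrPdist_le => e e0; rewrite /prop_near1/=.
have k1 : 0 < `|k| + 1 by rewrite ltr_wpDl.
near=> t.
apply: le_trans (gk _ _ xM _) _; first by near: t; exists 1 => //= t _; rewrite in_itv.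
have : `|x - t| < e / (`|k| + 1).
  near: t; exists (e / (`|k| + 1)) => /=; first by rewrite divr_gt0.
  by move=> t.
rewrite ltr_pdivlMr// => /ltW; apply: le_trans.
rewrite mulrC ler_wpM2l// (le_trans (ler_norm k))// lerDl//.
Unshelve. all: end_near. Qed.

(** The weight is to be the ratio of two wave measures, which is under control only
between the endpoints: elsewhere in [- M, M] it may be exponentially large. *)
Lemma weighted_oriented_integral_le psi w M W a y :
  mu.-integrable `[- M, M] (EFin \o psi) -> {within `[- M, M], continuous w} ->
  - M <= a <= M -> - M <= y <= M ->
  (forall x, Num.min a y <= x <= Num.max a y -> 0 <= w x <= W) ->
  `|oriented_integral a y (fun x => psi x * w x)| <= W * L1norm M psi.
Proof.
move=> psii wc aM yM wW.
have W0 : 0 <= W.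
  have /wW/andP[] : Num.min a y <= a <= Num.max a y by rewrite ge_min le_max lexx.
  exact: le_trans.
suff main b c : - M <= b <= M -> - M <= c <= M -> b <= c ->
    (forall x, b <= x <= c -> 0 <= w x <= W) ->
    `|\int[mu]_(x in `[b, c]) (psi x * w x)| <= W * L1norm M psi.
  rewrite /oriented_integral; case: (leP a y) wW => [ay|/ltW ay] wW; last rewrite normrN.
    by apply: main.
  by apply: main.
move=> /andP[Mb bM] /andP[Mc cM] bc {}wW.
have sub : `[b, c]%classic `<=` `[- M, M]%classic.
  by apply: subset_itv; rewrite bnd_simp.
have psib : mu.-integrable `[b, c] (EFin \o psi) by apply: integrableS psii.
have psiN : mu.-integrable `[- M, M] (EFin \o (fun x => `|psi x|)).
  exact: (integrable_norm psii).
have psibN : mu.-integrable `[b, c] (EFin \o (fun x => W * `|psi x|)).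
  have psiNb : mu.-integrable `[b, c] (EFin \o (fun x => `|psi x|)).
    by apply: integrableS psiN.
  have -> : EFin \o (fun x => W * `|psi x|) = (fun x => W%:E * `|psi x|%:E)%E by [].
  exact: integrableZl.
have wm : measurable_fun `[b, c] w.
  apply: (@measurable_funS _ _ _ _ `[- M, M]) => //.
  apply/measurable_EFinP.
  exact: (measurable_int mu (within_continuous_integrable wc)).
have pwi : mu.-integrable `[b, c] (EFin \o (fun x => psi x * w x)).
  apply: (le_integrable _ _ _ psibN) => //.
    apply/measurable_EFinP; apply: measurable_funM => //.
    by apply/measurable_EFinP; exact: (measurable_int mu).
  move=> x /=; rewrite in_itv/= => /wW /andP[w0 wx].
  rewrite lee_fin normrM (ger0_norm w0) mulrC.
  by rewrite [leRHS]ger0_norm ?mulr_ge0// ler_wpM2r.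
apply: le_trans (le_normr_Rintegral _ pwi) _ => //.
apply: (@le_trans _ _ (\int[mu]_(x in `[b, c]) (W * `|psi x|))).
  apply: le_Rintegral => //; first exact: (integrable_norm pwi).
  move=> x /=; rewrite in_itv/= => /wW /andP[w0 wx].
  by rewrite normrM (ger0_norm w0) mulrC ler_wpM2r.
rewrite RintegralZl//; last exact: integrableS psiN.
rewrite ler_wpM2l//; exact: Rintegral_subitv_le.
Qed.

End Increments.

(** * Phases close to a parabola, and their Gibbs measures *)

Section Profile.
Context {R : realType}.
Notation mu := (@lebesgue_measure R).
Context (M tau lam : R) (m g : R -> R).
Context (mi : mu.-integrable `[- M, M] (EFin \o m)) (gm : decreases_at_rate M m g).
Context (near : forall x, - M <= x <= M -> `|m x - (lam - x)| <= tau).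

(** A point moving from c towards r sees the phase drop only within distance 2 tau
of c, at a rate at most 2 tau: farther away m has the sign of lam - x, and the
phase increases with the distance to lam. *)
Lemma phase_center_le c r : - M <= c <= M -> - M <= r <= M ->
  `|c - lam| <= tau -> g c - g r <= 4 * tau ^+ 2.
Proof.
move=> /andP[Mc cM] /andP[Mr rM]; rewrite ler_distl => /andP[cl1 cl2].
have t0 : 0 <= tau by lra.
have near' t : - M <= t <= M -> lam - t - tau <= m t <= lam - t + tau.
  by move=> /near; rewrite ler_distl.
case: (leP c r) => [cr|/ltW rc].
  case: (leP r (c + 2 * tau)) => far.
    have : g c - g r <= 2 * tau * (r - c).
      apply: (drop_le mi gm) => // t /andP[ct tr].
      have /near' : - M <= t <= M by lra.
      lra.
    nra.
  have : g c - g (c + 2 * tau) <= 2 * tau * (c + 2 * tau - c).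
    apply: (drop_le mi gm) => //; try lra.
    move=> t /andP[ct tr]; have /near' : - M <= t <= M by lra.
    lra.
  have : g (c + 2 * tau) - g r <= 0 * (r - (c + 2 * tau)).
    apply: (drop_le mi gm) => //; try lra.
    move=> t /andP[et tr]; have /near' : - M <= t <= M by lra.
    lra.
  nra.
case: (leP (c - 2 * tau) r) => far.
  have : - (2 * tau) * (c - r) <= g r - g c.
    apply: (drop_ge mi gm) => // t /andP[rt tc].
    have /near' : - M <= t <= M by lra.
    lra.
  nra.
have : - (2 * tau) * (c - (c - 2 * tau)) <= g (c - 2 * tau) - g c.
  apply: (drop_ge mi gm) => //; try lra.
  move=> t /andP[ct tr]; have /near' : - M <= t <= M by lra.
  lra.
have : 0 * (c - 2 * tau - r) <= g r - g (c - 2 * tau).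
  apply: (drop_ge mi gm) => //; try lra.
  move=> t /andP[rt te]; have /near' : - M <= t <= M by lra.
  lra.
nra.
Qed.

(** On the way from c towards lam the phase drops at a rate at least 7 tau until
the distance to lam is 8 tau, and it remains nonnegative.  The stopping
point lies between c and c', hence in [- M, M]. *)
Lemma phase_far_ge c c' : - M <= c <= M -> - M <= c' <= M ->
  `|c' - lam| <= tau -> 15 * tau <= `|c - lam| ->
  (forall x, - M <= x <= M -> 0 <= g x) -> 49 * tau ^+ 2 <= g c.
Proof.
move=> /andP[Mc cM] /andP[Mc' c'M]; rewrite ler_distl => /andP[cl1 cl2] + g0.
have t0 : 0 <= tau by lra.
have near' t : - M <= t <= M -> lam - t - tau <= m t <= lam - t + tau.
  by move=> /near; rewrite ler_distl.
case: (leP c lam) => cl.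
  rewrite distrC ger0_norm ?subr_ge0// => far.
  have q0 : 0 <= g (lam - 8 * tau) by apply: g0; lra.
  have : 7 * tau * (lam - 8 * tau - c) <= g c - g (lam - 8 * tau).
    apply: (drop_ge mi gm) => //; try lra.
    move=> t /andP[ct te]; have /near' : - M <= t <= M by lra.
    lra.
  nra.
rewrite gtr0_norm ?subr_gt0// => far.
have q0 : 0 <= g (lam + 8 * tau) by apply: g0; lra.
have : g (lam + 8 * tau) - g c <= - (7 * tau) * (c - (lam + 8 * tau)).
  apply: (drop_le mi gm) => //; try lra.
  move=> t /andP[ct te]; have /near' : - M <= t <= M by lra.
  lra.
nra.
Qed.

End Profile.

Section Gibbs.
Context {R : realType}.
Notation mu := (@lebesgue_measure R).
Implicit Types (g psi : R -> R).

(** The normalizing integral of the measure attached to the phase g, in the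
language of statistical mechanics: energy g, temperature eps. *)
Definition partition_function (M eps : R) g : R :=
  \int[mu]_(x in `[- M, M]) expR (- g x / eps).

Definition gibbs (M eps : R) g (y : R) : R :=
  expR (- g y / eps) / partition_function M eps g.

Lemma boltzmann_continuous (M eps : R) g : {within `[- M, M], continuous g} ->
  {within `[- M, M], continuous (fun x => expR (- g x / eps))}.
Proof.
move=> gc x; apply: continuous_comp; last exact: continuous_expR.
by apply: cvgMl; apply: cvgN; exact: gc.
Qed.

Lemma partition_function_le (M eps : R) g : 0 <= M -> 0 < eps ->
  {within `[- M, M], continuous g} -> (forall x, - M <= x <= M -> 0 <= g x) ->
  partition_function M eps g <= 2 * M.
Proof.
move=> M0 eps0 gc g0.
have -> : 2 * M = 1 * (M - - M) by ring.
rewrite -Rintegral_itv_cst; last lra.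
apply: le_Rintegral => //.
- by apply: within_continuous_integrable; exact: boltzmann_continuous.
- exact: integrable_cst_itv.
- move=> x /=; rewrite in_itv/= => /g0 gx.
  rewrite -expR0 ler_expR mulNr oppr_le0 divr_ge0// ltW//.
Qed.

(** Around a zero r of g, the energy is at most eps on any interval of length
at most eps / L. *)
Lemma partition_function_ge (M eps L r : R) g : 0 < M -> 0 < eps -> 0 <= L ->
  (forall x y, - M <= x <= M -> - M <= y <= M -> `|g x - g y| <= L * `|x - y|) ->
  - M <= r <= M -> g r = 0 ->
  expR (- 1) / (M^-1 + L / eps) <= partition_function M eps g.
Proof.
move=> M0 eps0 L0 gL /andP[Mr rM] gr.
have gc := lipschitz_within_continuous gL.
have ei := within_continuous_integrable (boltzmann_continuous (eps := eps) gc).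
(* A smooth substitute for the minimum of M and eps / L: an interval of length s
   that starts at r and goes towards 0 stays in [- M, M]. *)
set s := (M^-1 + L / eps)^-1.
have Mi0 : 0 < M^-1 by rewrite invr_gt0.
have Le0 : 0 <= L / eps by rewrite divr_ge0// ltW.
have d0 : 0 < M^-1 + L / eps by lra.
have s0 : 0 < s by rewrite invr_gt0.
have sM : s <= M by rewrite -[leRHS]invrK lef_pV2 ?posrE//; lra.
have sL : L / eps * s <= 1 by rewrite ler_pdivrMr// mul1r; lra.
have key a b : - M <= a -> b <= M -> b - a = s -> a <= r <= b ->
    expR (- 1) * s <= partition_function M eps g.
  move=> Ma bM bas /andP[ar rb].
  rewrite -bas -Rintegral_itv_cst; last lra.
  apply: le_trans (Rintegral_subitv_le ei Ma bM _); last first.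
    by move=> x _; exact: expR_ge0.
  apply: le_Rintegral => //; first exact: integrable_cst_itv.
    apply: integrableS ei => //; apply: subset_itv; by rewrite bnd_simp.
  move=> x /=; rewrite in_itv/= => /andP[ax xb].
  rewrite ler_expR mulNr lerN2 ler_pdivrMr// mul1r.
  have := gL x r; rewrite gr subr0 => /(_ _ _)/(le_trans (ler_norm _)) => h.
  apply: le_trans (h _ _) _; [lra|lra|].
  have xr : `|x - r| <= s by rewrite ler_distl; lra.
  apply: (@le_trans _ _ (L * s)); first exact: ler_wpM2l.
  by move: sL; rewrite mulrAC ler_pdivrMr// mul1r.
case: (leP r 0) => r0.
  by apply: (key r (r + s)); lra.
by apply: (key (r - s) r); lra.
Qed.

End Gibbs.

(** * Interaction of two waves *)

Section TwoWaves.
Context {R : realType}.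
Notation mu := (@lebesgue_measure R).

Lemma gibbs_ratio (M eps : R) (f g : R -> R) (x : R) :
  gibbs M eps f x / gibbs M eps g x =
  expR ((g x - f x) / eps) * (partition_function M eps g / partition_function M eps f).
Proof.
rewrite /gibbs invf_div (mulrC (partition_function M eps g)) mulrACA.
rewrite -expRN -expRD [X in _ * X]mulrC; congr (expR _ * _); ring.
Qed.

(** From a / eps <= exp (a / eps); this is what makes constants independent of
eps. *)
Lemma exp_small_absorbs (a b L eps : R) : 0 < a -> 0 < eps -> 0 <= b -> 0 <= L ->
  expR (- a / eps) * (b + L / eps) <= b + L / a.
Proof.
move=> a0 e0 b0 L0; rewrite mulrDr lerD//.
  rewrite ler_piMl// -expR0 ler_expR mulNr oppr_le0 divr_ge0// ltW//.
rewrite mulrCA ler_wpM2l//.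
rewrite mulNr expRN -invfM lef_pV2 ?posrE ?mulr_gt0 ?expR_gt0//.
rewrite -ler_pdivrMr//; have := expR_ge1Dx (a / eps); lra.
Qed.

(** A point where the energy of f exceeds that of g by a fixed a carries
exponentially less mass of f, while the ratio of the partition functions is only
O(1 + 1 / eps). *)
Lemma gibbs_ratio_le (M eps a L r x : R) (f g : R -> R) :
  0 < M -> 0 < eps -> 0 < a -> 0 <= L ->
  (forall x y, - M <= x <= M -> - M <= y <= M -> `|f x - f y| <= L * `|x - y|) ->
  {within `[- M, M], continuous g} -> (forall x, - M <= x <= M -> 0 <= g x) ->
  - M <= r <= M -> f r = 0 -> a <= f x - g x ->
  gibbs M eps f x / gibbs M eps g x <= 2 * M * expR 1 * (M^-1 + L / a).
Proof.
move=> M0 e0 a0 L0 fL gc g0 rM fr afg.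
have Zg := partition_function_le (ltW M0) e0 gc g0.
have Zf := partition_function_ge M0 e0 L0 fL rM fr.
have d0 : 0 < M^-1 + L / eps.
  by rewrite ltr_pwDl ?invr_gt0// divr_ge0// ltW.
have Zf0 : 0 < expR (- 1) / (M^-1 + L / eps) :> R by rewrite divr_gt0 ?expR_gt0.
rewrite gibbs_ratio.
apply: (@le_trans _ _ (expR (- a / eps) *
    (2 * M * (expR 1 * (M^-1 + L / eps))))).
  apply: ler_pM; rewrite ?expR_ge0//.
  - apply: divr_ge0; last exact: le_trans (ltW Zf0) Zf.
    by apply: Rintegral_ge0 => t _; exact: expR_ge0.
  - by rewrite ler_expR ler_pM2r ?invr_gt0//; lra.
  - apply: ler_pM => //.
    + by apply: Rintegral_ge0 => t _; exact: expR_ge0.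
    + by rewrite invr_ge0 (le_trans (ltW Zf0)).
    + rewrite -[leRHS]invrK lef_pV2 ?posrE ?invr_gt0 ?mulr_gt0 ?expR_gt0//.
        by rewrite invfM -expRN.
      exact: lt_le_trans Zf.
have -> : expR (- a / eps) * (2 * M * (expR 1 * (M^-1 + L / eps))) =
    2 * M * expR 1 * (expR (- a / eps) * (M^-1 + L / eps)) by ring.
apply: ler_wpM2l; first by rewrite !mulr_ge0 ?expR_ge0// ltW.
apply: exp_small_absorbs => //; first by rewrite invr_ge0 ltW.
Qed.

Lemma gibbs_gt0 (M eps : R) (g : R -> R) x :
  0 < partition_function M eps g -> 0 < gibbs M eps g x.
Proof. by move=> Z0; rewrite divr_gt0 ?expR_gt0. Qed.

Lemma slower_rate_drops_less (M : R) (m1 m2 g1 g2 : R -> R) (x y : R) :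
  mu.-integrable `[- M, M] (EFin \o m1) -> mu.-integrable `[- M, M] (EFin \o m2) ->
  decreases_at_rate M m1 g1 -> decreases_at_rate M m2 g2 ->
  (forall t, - M <= t <= M -> m1 t <= m2 t) ->
  - M <= x -> x <= y -> y <= M -> g1 x - g2 x <= g1 y - g2 y.
Proof.
move=> mi1 mi2 gm1 gm2 m12 Mx xy yM.
suff : g1 x - g1 y <= g2 x - g2 y by lra.
rewrite gm1// gm2//; apply: le_Rintegral => //.
- by apply: integrableS mi1 => //; apply: subset_itv; rewrite bnd_simp.
- by apply: integrableS mi2 => //; apply: subset_itv; rewrite bnd_simp.
- by move=> t /=; rewrite in_itv/= => /andP[xt ty]; apply: m12; lra.
Qed.

(** The ratio is monotone on the segment, so its maximum is at one of the two ends;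
the sum of the two end values avoids deciding which. *)
Lemma gibbs_ratio_le_ends (M eps c y x : R) (f g : R -> R) : 0 < eps ->
  0 < partition_function M eps f -> 0 < partition_function M eps g ->
  (forall s t, Num.min c y <= s -> s <= t -> t <= Num.max c y ->
     g s - f s <= g t - f t) \/
  (forall s t, Num.min c y <= s -> s <= t -> t <= Num.max c y ->
     g t - f t <= g s - f s) ->
  Num.min c y <= x <= Num.max c y ->
  gibbs M eps f x / gibbs M eps g x <=
  gibbs M eps f c / gibbs M eps g c + gibbs M eps f y / gibbs M eps g y.
Proof.
move=> e0 Zf Zg mono /andP[x1 x2].
have w0 t : 0 <= gibbs M eps f t / gibbs M eps g t.
  by rewrite divr_ge0 ?ltW ?gibbs_gt0.
have mon s t : g s - f s <= g t - f t ->
    gibbs M eps f s / gibbs M eps g s <= gibbs M eps f t / gibbs M eps g t.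
  move=> h; rewrite !gibbs_ratio; apply: ler_wpM2r.
    by apply: divr_ge0; apply: ltW.
  by rewrite ler_expR ler_pM2r ?invr_gt0.
have [t tcy xt] : exists2 t, t = c \/ t = y & g x - f x <= g t - f t.
  case: mono => mono.
    exists (Num.max c y); last exact: mono.
    by rewrite /Num.max; case: ifP; [right|left].
  exists (Num.min c y); last exact: mono.
  by rewrite /Num.min; case: ifP; [left|right].
apply: le_trans (mon _ _ xt) _.
by case: tcy => ->; rewrite ?lerDl ?lerDr.
Qed.

Lemma end_terms_le (p q s C : R) : 0 <= p -> 0 <= q -> 0 <= s -> s <= C ->
  s * p + q <= (1 + C) * (q + p).
Proof. by move=> p0 q0 s0 sC; nra. Qed.

(** The 1 comes from the end y of the segment, and the rest bounds the ratio of the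
two measures at the end ci: 45 tau ^+ 2 is the energy gap there and
2 * M + 2 * tau a Lipschitz constant of the phases. *)
Definition interaction_constant (M tau : R) : R :=
  1 + 2 * M * expR 1 * (M^-1 + (2 * M + 2 * tau) / (45 * tau ^+ 2)).

(** The estimate for two phases whose rates are tau-close to lami - x and lamj - x.
Both orders of the speeds are covered: the order only decides whether the ratio of
the measures increases or decreases. *)
Lemma two_wave_interaction_le (M eps tau lami lamj ci cj ri rj y : R)
    (mi mj gi gj psi : R -> R) :
  0 < M -> 0 < eps -> 0 < tau ->
  {within `[- M, M], continuous mi} -> {within `[- M, M], continuous mj} ->
  decreases_at_rate M mi gi -> decreases_at_rate M mj gj ->
  (forall x, - M <= x <= M -> `|mi x - (lami - x)| <= tau) ->
  (forall x, - M <= x <= M -> `|mj x - (lamj - x)| <= tau) ->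
  (forall x, - M <= x <= M -> 0 <= gi x) ->
  (forall x, - M <= x <= M -> 0 <= gj x) ->
  - M <= ri <= M -> - M <= rj <= M -> gi ri = 0 -> gj rj = 0 ->
  - M <= ci <= M -> - M <= cj <= M ->
  `|ci - lami| <= tau -> `|cj - lamj| <= tau -> 16 * tau <= `|lami - lamj| ->
  mu.-integrable `[- M, M] (EFin \o psi) -> - M <= y <= M ->
  `|gibbs M eps gi y * oriented_integral ci y
      (fun x => psi x * (gibbs M eps gj x / gibbs M eps gi x))| <=
  interaction_constant M tau * L1norm M psi *
    (gibbs M eps gj y + gibbs M eps gi y).
Proof.
move=> M0 e0 t0 mic mjc gmi gmj neari nearj gi0 gj0 riM rjM giri gjrj ciM cjM
  cil cjl sep psii yM.
have mii := within_continuous_integrable mic.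
have mji := within_continuous_integrable mjc.
pose L := 2 * M + 2 * tau.
have bnd (m : R -> R) lam c : - M <= c <= M -> `|c - lam| <= tau ->
    (forall x, - M <= x <= M -> `|m x - (lam - x)| <= tau) ->
    forall x, - M <= x <= M -> `|m x| <= L.
  move=> cM; rewrite ler_distl => cl nm x xM; have := nm x xM.
  rewrite ler_distl ler_norml /L; lra.
have giL x x' := rate_lipschitz mii gmi (bnd _ _ _ ciM cil neari) (x := x) (y := x').
have gjL x x' := rate_lipschitz mji gmj (bnd _ _ _ cjM cjl nearj) (x := x) (y := x').
have L0 : 0 <= L by rewrite /L; lra.
have Zpos g r : (forall x x', - M <= x <= M -> - M <= x' <= M ->
    `|g x - g x'| <= L * `|x - x'|) -> - M <= r <= M -> g r = 0 ->
    0 < partition_function M eps g.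
  move=> gL rM gr; apply: lt_le_trans (partition_function_ge M0 e0 L0 gL rM gr).
  rewrite divr_gt0 ?expR_gt0// ltr_pwDl ?invr_gt0// divr_ge0// ltW//.
have Zi := Zpos _ _ giL riM giri.
have Zj := Zpos _ _ gjL rjM gjrj.
pose w x := gibbs M eps gj x / gibbs M eps gi x.
have gic := lipschitz_within_continuous giL.
have gjc := lipschitz_within_continuous gjL.
have wc : {within `[- M, M], continuous w}.
  have -> : w = fun x => expR (- (gj x - gi x) / eps) *
      (partition_function M eps gi / partition_function M eps gj).
    by apply/funext => x; rewrite /w gibbs_ratio opprB.
  move=> x; apply: cvgMl.
  apply: (@boltzmann_continuous _ _ _ (fun x => gj x - gi x)) => {}x.
  by apply: cvgB; [exact: gjc|exact: gic].
have wci : w ci <= 2 * M * expR 1 * (M^-1 + L / (45 * tau ^+ 2)).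
  apply: gibbs_ratio_le e0 _ L0 gjL gic gi0 rjM gjrj _ => //.
    by rewrite mulr_gt0// exprn_gt0.
  have far : 15 * tau <= `|ci - lamj|.
    have := ler_distD ci lami lamj; rewrite (distrC lami ci); lra.
  have := phase_far_ge mji gmj nearj ciM cjM cjl far gj0.
  have := phase_center_le mii gmi neari ciM riM cil; rewrite giri subr0; lra.
have mono : (forall s t, Num.min ci y <= s -> s <= t -> t <= Num.max ci y ->
     gi s - gj s <= gi t - gj t) \/
  (forall s t, Num.min ci y <= s -> s <= t -> t <= Num.max ci y ->
     gi t - gj t <= gi s - gj s).
  have inM s t : Num.min ci y <= s -> t <= Num.max ci y -> - M <= s /\ t <= M.
    have [/andP[Mc cM] /andP[My yM']] := (ciM, yM).
    rewrite ge_min le_max => /orP[] sh /orP[] th;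
      by split; [exact: le_trans sh|exact: le_trans th _].
  have near2 t : - M <= t <= M ->
      lami - t - tau <= mi t <= lami - t + tau /\
      lamj - t - tau <= mj t <= lamj - t + tau.
    by move=> tM; move: (neari t tM) (nearj t tM); rewrite !ler_distl.
  case: (leP lami lamj) => lij; [left|right] => s t cs st tc;
      have [Ms tM] := inM s t cs tc.
    apply: (slower_rate_drops_less mii mji gmi gmj) => // x /near2[].
    move: sep; rewrite distrC ger0_norm ?subr_ge0//; lra.
  rewrite -lerN2 !opprB; apply: (slower_rate_drops_less mji mii gmj gmi) => //.
  by move=> x /near2[]; move: sep; rewrite gtr0_norm ?subr_gt0//; lra.
have wle := weighted_oriented_integral_le psii wc ciM yM
  (W := w ci + w y).
have gi0' := gibbs_gt0 y Zi; have gj0' := gibbs_gt0 y Zj.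
have w0 x : 0 <= w x by apply: divr_ge0; apply/ltW/gibbs_gt0.
rewrite normrM gtr0_norm//.
apply: (@le_trans _ _ (gibbs M eps gi y * ((w ci + w y) * L1norm M psi))).
  apply: ler_wpM2l; first exact: ltW.
  apply: wle => x xcy; rewrite w0 /=.
  exact: gibbs_ratio_le_ends e0 Zj Zi mono xcy.
have -> : gibbs M eps gi y * ((w ci + w y) * L1norm M psi) =
    L1norm M psi * (w ci * gibbs M eps gi y + gibbs M eps gj y).
  have <- : w y * gibbs M eps gi y = gibbs M eps gj y by rewrite mulfVK// gt_eqF.
  ring.
have N0 : 0 <= L1norm M psi by apply: Rintegral_ge0.
rewrite [leRHS]mulrAC [leRHS]mulrC; apply: ler_wpM2l => //.
exact: end_terms_le (ltW gi0') (ltW gj0') (w0 ci) wci.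
Qed.

End TwoWaves.

(** * Continuity of ordered roots *)

Lemma ord_homo_ge (N : nat) (s : 'I_N -> 'I_N) :
  (forall i j : 'I_N, (i < j)%N -> (s i < s j)%N) -> forall i : 'I_N, (i <= s i)%N.
Proof.
move=> sm [n nN]; elim: n nN => [//|n IH] nN /=.
apply: leq_ltn_trans (IH (ltnW nN)) _; exact: sm.
Qed.

Lemma ord_homo_id (N : nat) (s : 'I_N -> 'I_N) :
  (forall i j : 'I_N, (i < j)%N -> (s i < s j)%N) -> forall i, s i = i.
Proof.
move=> sm i; apply/val_inj/eqP; rewrite eqn_leq (ord_homo_ge sm) andbT.
have rev_lt (j k : 'I_N) : (rev_ord j < rev_ord k)%N = (k < j)%N.
  by rewrite /= ltn_sub2lE// ltnS.
have := @ord_homo_ge _ (fun j => rev_ord (s (rev_ord j))) _ (rev_ord i).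
rewrite rev_ordK leqNgt rev_lt -leqNgt; apply => j k jk.
by rewrite rev_lt sm// rev_lt.
Qed.

Section Roots.
Context {R : realType}.

Lemma det_cvg (T : Type) (F : set_system T) (FF : Filter F) (n : nat)
    (A : T -> 'M[R]_n) (A0 : 'M[R]_n) :
  (forall i j, A x i j @[x --> F] --> A0 i j) ->
  \det (A x) @[x --> F] --> \det A0.
Proof.
move=> AA; apply: cvg_big => [|s _]; first exact: add_continuous.
apply: cvgM; first exact: cvg_cst.
by apply: cvg_big => [|i _]; [exact: mul_continuous|exact: AA].
Qed.

(** At the limit point the function of t changes sign across each a k, at the
distance d on both sides.  Nearby it still does, so some root lies within d
of a k.  These neighbourhoods are disjoint and the roots are listed in increasing
order, so the root close to a k has index k. *)
Lemma ordered_roots_cvg (T : Type) (F : set_system T) (FF : Filter F) (n : nat)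
    (b : T -> R) (b0 gap : R) (m : 'I_n -> T -> R) (a : 'I_n -> R) :
  b0 != 0 -> 0 < gap ->
  (forall i j : 'I_n, (i < j)%N -> a i + gap <= a j) ->
  (\forall x \near F, forall i j : 'I_n, (i < j)%N -> m i x < m j x) ->
  (forall t, b x * \prod_i (m i x - t) @[x --> F] --> b0 * \prod_i (a i - t)) ->
  forall i, m i x @[x --> F] --> a i.
Proof.
move=> b00 gap0 agap mlt qcvg i; apply/cvgrPdist_lt => e e0.
pose d := Num.min e (gap / 2).
have d0 : 0 < d by rewrite lt_min e0 divr_gt0.
have de : d <= e by rewrite ge_min lexx.
have dgap : d <= gap / 2 by rewrite ge_min lexx orbT.
have root_near k : \forall x \near F, exists l, `|a k - m l x| < d.
  have := cvgM (qcvg (a k - d)) (qcvg (a k + d)).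
  set y0 := (X in _ --> X); have y00 : y0 < 0.
    rewrite /y0 mulrACA -big_split/= (bigD1 k)//=.
    rewrite pmulr_rlt0; last by rewrite -expr2 exprn_even_gt0.
    rewrite pmulr_llt0.
      have -> : (a k - (a k - d)) * (a k - (a k + d)) = - (d * d) by ring.
      by rewrite oppr_lt0 mulr_gt0.
    apply: prodr_gt0 => l lk.
    have -> : (a l - (a k - d)) * (a l - (a k + d)) = (a l - a k) ^+ 2 - d ^+ 2 by ring.
    have [kl|kl|/val_inj kl] := ltngtP k l; last by rewrite kl eqxx in lk.
      have := agap _ _ kl; nra.
    have := agap _ _ kl; nra.
  move=> h; apply: filterS (cvgr_lt _ (h FF) _ y00) => x.
  rewrite /= mulrACA -big_split/=; apply: contraPP => /forallNP nol.
  apply/negP; rewrite -leNgt mulr_ge0//; first by rewrite -expr2 sqr_ge0.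
  apply: prodr_ge0 => l _; have /negP := nol l; rewrite -leNgt.
  have -> : (m l x - (a k - d)) * (m l x - (a k + d)) = (a k - m l x) ^+ 2 - d ^+ 2 by ring.
  move=> h'; rewrite subr_ge0 -[leRHS]real_normK ?num_real//.
  by rewrite lerXn2r// nnegrE// ltW.
have all_near : \forall x \near F, forall k, exists l, `|a k - m l x| < d.
  exact: filter_forall.
near=> x.
have [s sd] : exists s : 'I_n -> 'I_n, forall k, `|a k - m (s k) x| < d.
  by apply: (@fin_all_exists _ (fun=> 'I_n) (fun k l => `|a k - m l x| < d)); near: x.
have mx : forall i j : 'I_n, (i < j)%N -> m i x < m j x by near: x.
have sid : forall k, s k = k.
  apply: ord_homo_id => k l kl; rewrite ltnNge; apply/negP => slk.
  have : m (s l) x <= m (s k) x.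
    move: slk; rewrite leq_eqVlt => /predU1P[/val_inj ->//|/mx/ltW//].
  have := sd k; have := sd l; have := agap _ _ kl.
  rewrite !ltr_distl; lra.
by rewrite (lt_le_trans _ de)// -{2}(sid i).
Unshelve. all: end_near. Qed.

(** The rows of P and the columns of Q reduce B to the identity and A to
a diagonal matrix simultaneously. *)
Lemma det_pencil (n : nat) (A B P Q : 'M[R]_n) (m : 'I_n -> R) (t : R) :
  P *m B *m Q = 1%:M ->
  (forall j, A *m col j Q = m j *: (B *m col j Q)) ->
  \det (A - t *: B) = \det B * \prod_i (m i - t).
Proof.
move=> PBQ AQ.
have detPBQ : \det P * \det B * \det Q = 1 by rewrite -!det_mulmx PBQ det1.
have AQE : A *m Q = B *m Q *m diag_mx (\row_j m j).
  apply/matrixP => i j; have /matrixP/(_ i 0) := AQ j.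
  rewrite mul_mx_diag !colE !mulmxA -!colE !mxE => ->; exact: mulrC.
have -> : \prod_i (m i - t) = \det (P *m (A - t *: B) *m Q).
  rewrite mulmxBr mulmxBl -scalemxAr -scalemxAl PBQ -mulmxA AQE !mulmxA PBQ mul1mx.
  have -> : diag_mx (\row_j m j) - t *: 1%:M = diag_mx (\row_j (m j - t)).
    apply/matrixP => i j; rewrite !mxE.
    by case: eqVneq => _; rewrite ?mulr1n ?mulr0n ?mulr1 ?mulr0 ?subr0.
  by rewrite det_diag; apply: eq_bigr => i _; rewrite mxE.
rewrite !det_mulmx [in RHS]mulrC -[LHS]mul1r -detPBQ; ring.
Qed.

End Roots.

(** * Rayleigh quotients relative to a near-identity matrix *)

Section Rayleigh.
Context {R : realType} {N : nat}.
Implicit Types (x y : 'cV[R]_N) (A B : 'M[R]_N).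

Lemma dot_mulmx x y : dot x y = (x^T *m y) 0 0.
Proof. by rewrite mxE; apply: eq_bigr => k _; rewrite mxE. Qed.

Lemma dotDr x y z : dot x (y + z) = dot x y + dot x z.
Proof. by rewrite !dot_mulmx mulmxDr mxE. Qed.

Lemma dotZr x (a : R) y : dot x (a *: y) = a * dot x y.
Proof. by rewrite !dot_mulmx -scalemxAr mxE. Qed.

Lemma dot_unit_entry x i : dot x x = 1 -> `|x i 0| <= 1.
Proof.
move=> x1; rewrite -(@ler_pXn2r _ 2)// ?nnegrE// expr1n -x1 real_normK ?num_real//.
rewrite /dot (bigD1 i)//= -expr2 lerDl; apply: sumr_ge0 => k _.
by rewrite -expr2 sqr_ge0.
Qed.

Lemma dot_near_id x B eta : dot x x = 1 -> `|B - 1%:M| <= eta ->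
  `|dot x (B *m x) - 1| <= N%:R ^+ 2 * eta.
Proof.
move=> x1 Beta.
have -> : dot x (B *m x) - 1 = \sum_i \sum_j x i 0 * ((B - 1%:M) i j * x j 0).
  rewrite -[X in _ - X = _]x1 /dot -sumrB; apply: eq_bigr => i _.
  rewrite -mulr_sumr -mulrBr; congr (_ * _).
  have -> : x i 0 = (1%:M *m x) i 0 by rewrite mul1mx.
  by rewrite !mxE -sumrB; apply: eq_bigr => j _; rewrite !mxE mulrBl.
apply: le_trans (ler_norm_sum _ _ _) _.
have -> : N%:R ^+ 2 * eta = \sum_(i < N) \sum_(j < N) eta.
  by rewrite !sumr_const !card_ord -mulrnA -[RHS]mulr_natl natrM expr2.
apply: ler_sum => i _; apply: le_trans (ler_norm_sum _ _ _) _.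
apply: ler_sum => j _; rewrite !normrM.
have Bij : `|(B - 1%:M) i j| <= eta.
  apply: le_trans Beta; rewrite [leRHS]/Num.norm/= mx_normrE.
  exact: (le_bigmax _ (fun ij => `|(B - 1%:M) ij.1 ij.2|) (i, j)).
have xi := dot_unit_entry i x1; have xj := dot_unit_entry j x1.
apply: (@le_trans _ _ (1 * (eta * 1))); last by rewrite mulr1 mul1r.
by apply: ler_pM => //; apply: ler_pM.
Qed.

(** Taking the dot product of the eigenvalue relation with x gives
(x . A x) - xi = mu (x . B x), and x . B x is close to 1; its lower bound 1 / 2
first gives |mu| <= 2 S. *)
Lemma rayleigh_near x A B (xi mu eta S : R) : dot x x = 1 ->
  `|B - 1%:M| <= eta -> N%:R ^+ 2 * eta <= 1 / 2 ->
  (- xi%:M + A) *m x = mu *: (B *m x) ->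
  `|dot x (A *m x) - xi| <= S ->
  `|mu - (dot x (A *m x) - xi)| <= 2 * S * (N%:R ^+ 2 * eta).
Proof.
move=> x1 Beta small eig; have := dot_near_id x1 Beta.
set th := N%:R ^+ 2 * eta in small *.
have : dot x (A *m x) - xi = mu * dot x (B *m x).
  rewrite -dotZr -eig mulmxDl mulNmx mul_scalar_mx dotDr -scaleNr dotZr x1.
  by rewrite mulr1 addrC.
set s := dot x (A *m x) - xi; set b := dot x (B *m x).
move=> -> bth sS.
have -> : mu - mu * b = mu * (1 - b) by ring.
rewrite normrM distrC; apply: ler_pM => //.
move: sS; rewrite normrM.
have hb : 1 / 2 <= `|b|.
  by move: bth; rewrite ler_distl => ?; apply: le_trans (ler_norm b); lra.
have := normr_ge0 mu; nra.
Qed.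

End Rayleigh.

(** * Continuity of the generalized eigenvalues along a state *)

Section AlongState.
Context {R : realType} {N : nat}.
Context (M delta0 : R) (u : R -> 'cV[R]_N) (v : R -> R).
Context (uc : {within `[- M, M], continuous u}).
Context (vc : {within `[- M, M], continuous v}).
Context (uvD : forall x : R, x \in `[- M, M] -> domain delta0 (u x, v x)).

Lemma smooth_field_cvg (F : 'cV[R]_N -> R -> 'M[R]_N) a b (x : R) :
  smooth_field delta0 F -> x \in `[- M, M] ->
  F (u t) (v t) a b @[t --> within `[- M, M] (nbhs x)] --> F (u x) (v x) a b.
Proof.
move=> /(_ a b)[U [g [oU DU gs Fg]]] xM.
have ux := (subspace_continuousP _ _).1 uc x xM.
have vx := (subspace_continuousP _ _).1 vc x xM.
have gx := (gs [::] _ (DU _ (uvD xM))).1.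
rewrite (Fg _ (uvD xM)).
have gcvg : g (u t, v t) @[t --> within `[- M, M] (nbhs x)] --> g (u x, v x).
  apply: (@cvg_comp _ _ _ (fun t => (u t, v t)) g _ (nbhs (u x, v x))).
    exact: (@cvg_pair _ _ _ _ (nbhs (u x)) (nbhs (v x)) _ _ _ u v ux vx).
  exact: gx.
apply: cvg_trans gcvg; apply: near_eq_cvg.
by apply: filterS (withinT _ _) => t tM; rewrite -Fg//; exact: uvD.
Qed.

Context (A0 A1 B0 : 'cV[R]_N -> R -> 'M[R]_N) (mu : 'I_N -> 'cV[R]_N -> R -> R -> R)
  (lhat rhat : 'I_N -> 'cV[R]_N -> R -> R -> 'cV[R]_N) (gap : R).
Context (sA0 : smooth_field delta0 A0) (sA1 : smooth_field delta0 A1)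
  (sB0 : smooth_field delta0 B0).
Context (unitA0 : forall u v, domain delta0 (u, v) -> A0 u v \in unitmx).
Context (unitB0 : forall u v, domain delta0 (u, v) -> B0 u v \in unitmx).
Context (eig : forall u v xi, domain delta0 (u, v) -> - M <= xi <= M ->
  forall i, (- xi%:M + normalized A0 A1 u v) *m rhat i u v xi =
            mu i u v xi *: (normalized A0 B0 u v *m rhat i u v xi)).
Context (dual : forall u v xi, domain delta0 (u, v) -> - M <= xi <= M ->
  forall i j, dot (lhat i u v xi) (normalized A0 B0 u v *m rhat j u v xi) =
              (i == j)%:R).

(** The factor A0 clears the inverses in the normalized fields, so only the smooth
fields A0, A1, B0 appear on the left. *)
Lemma det_generalized_pencil w z xi t : domain delta0 (w, z) -> - M <= xi <= M ->
  \det (A1 w z - xi *: A0 w z - t *: B0 w z) =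
  \det (B0 w z) * \prod_i (mu i w z xi - t).
Proof.
move=> wD xiM; have A0u := unitA0 wD.
have -> : A1 w z - xi *: A0 w z - t *: B0 w z =
    ((- xi%:M + normalized A0 A1 w z) - t *: normalized A0 B0 w z) *m A0 w z.
  rewrite mulmxBl mulmxDl -scalemxAl !mulmxKV// mulNmx mul_scalar_mx.
  by rewrite [- _ + _]addrC.
rewrite det_mulmx.
pose P := \matrix_(i, k) lhat i w z xi k 0.
pose Q := \matrix_(k, j) rhat j w z xi k 0.
have colQ j : col j Q = rhat j w z xi by apply/colP => k; rewrite !mxE.
rewrite (@det_pencil _ _ _ _ P Q (fun i => mu i w z xi)); last 2 first.
- apply/matrixP => i j; rewrite [RHS]mxE -(dual wD xiM) -mulmxA mxE.
  apply: eq_bigr => k _; rewrite [P i k]mxE -colQ; congr (_ * _).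
  by rewrite colE mulmxA -colE [RHS]mxE.
- by move=> j; rewrite colQ eig.
by rewrite mulrAC -det_mulmx mulmxKV.
Qed.

Context (gap0 : 0 < gap).
Context (mu_gap : forall u v xi, domain delta0 (u, v) -> - M <= xi <= M ->
  forall i j : 'I_N, (i < j)%N -> mu i u v xi + gap <= mu j u v xi).

(** For each fixed t the pencil determinant is continuous along (u, v), being
polynomial in the entries of smooth fields; its ordered roots follow. *)
Lemma eigenvalue_continuous i :
  {within `[- M, M], continuous (fun x => mu i (u x) (v x) x)}.
Proof.
apply/subspace_continuousP => x xM.
have D' y : y \in `[- M, M] -> domain delta0 (u y, v y) /\ - M <= y <= M.
  by move=> yM; split; [exact: uvD|move: yM; rewrite in_itv].
have [xD x'] := D' _ xM.
apply: (@ordered_roots_cvg _ _ _ _ _ (fun y => \det (B0 (u y) (v y)))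
  (\det (B0 (u x) (v x))) gap
  (fun i y => mu i (u y) (v y) y) (fun i => mu i (u x) (v x) x)) => //.
- by have := unitB0 xD; rewrite unitmxE unitfE.
- by move=> k l kl; exact: mu_gap.
- apply: filterS (withinT _ _) => y yM k l kl; have [yD y'] := D' _ yM.
  by apply: lt_le_trans (mu_gap yD y' kl); rewrite ltrDl.
move=> t; rewrite -det_generalized_pencil//.
apply: (@cvg_trans _ (\det (A1 (u y) (v y) - y *: A0 (u y) (v y) - t *: B0 (u y) (v y))
    @[y --> within `[- M, M] (nbhs x)])).
  apply: near_eq_cvg; apply: filterS (withinT _ _) => y yM; have [yD y'] := D' _ yM.
  by rewrite det_generalized_pencil.
apply: det_cvg => a b.
have -> : (A1 (u x) (v x) - x *: A0 (u x) (v x) - t *: B0 (u x) (v x)) a b =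
  A1 (u x) (v x) a b - x * A0 (u x) (v x) a b - t * B0 (u x) (v x) a b.
  by rewrite !mxE.
under eq_fun do rewrite !mxE.
apply: cvgB; last by apply: cvgMr; exact: smooth_field_cvg.
apply: cvgB; first exact: smooth_field_cvg.
apply: cvgM; last exact: smooth_field_cvg.
by apply: cvg_within.
Qed.

End AlongState.

(** * Smallness of the parameters and the estimate *)

Section Assembly.
Context {R : realType} {N : nat}.

Lemma increasing_gap (lam0 : 'I_N -> R) :
  (forall i j : 'I_N, (i < j)%N -> lam0 i < lam0 j) ->
  exists2 gap : R, 0 < gap & forall i j : 'I_N, (i < j)%N -> lam0 i + gap <= lam0 j.
Proof.
move=> lt0; pose d (p : 'I_N * 'I_N) := lam0 p.2 - lam0 p.1.
exists (\big[Order.min/1]_(p : 'I_N * 'I_N | (p.1 < p.2)%N) d p).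
  by apply: lt_bigmin => // p p12; rewrite subr_gt0 lt0.
move=> i j ij; rewrite addrC -lerBrDr.
exact: (@bigmin_le_cond _ _ _ _ (i, j) (fun p : 'I_N * 'I_N => (p.1 < p.2)%N) d).
Qed.

Lemma phase_rate (M : R) (mu : 'I_N -> 'cV[R]_N -> R -> R -> R)
    (u : R -> 'cV[R]_N) (v : R -> R) (rho : 'I_N -> R) k :
  {within `[- M, M], continuous (fun x => mu k (u x) (v x) x)} ->
  - M <= rho k <= M ->
  decreases_at_rate M (fun x => mu k (u x) (v x) x) (phase mu u v rho k).
Proof.
move=> mc rM x y Mx xy yM; rewrite /phase opprK addrC.
exact: (oriented_integralB (within_continuous_integrable mc)).
Qed.

Lemma phase_origin (mu : 'I_N -> 'cV[R]_N -> R -> R -> R)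
    (u : R -> 'cV[R]_N) (v : R -> R) (rho : 'I_N -> R) k :
  phase mu u v rho k (rho k) = 0.
Proof.
by rewrite /phase /oriented_integral lexx set_itv1 Rintegral_set1 oppr0.
Qed.

(** Half of tau is spent on the Rayleigh quotient rhat . A rhat, which is within
K delta0 + K eta of lam0, the other half on replacing mu by
rhat . A rhat - xi. *)
Lemma eigenvalue_near (M K delta0 eta tau : R) (lam0 : 'I_N -> R)
    (A0 A1 B0 : 'cV[R]_N -> R -> 'M[R]_N) (lam : 'I_N -> 'cV[R]_N -> R -> R)
    (l r : 'I_N -> 'cV[R]_N -> R -> 'cV[R]_N) (Lamlo Lamhi : 'I_N -> R)
    (mu : 'I_N -> 'cV[R]_N -> R -> R -> R)
    (lhat rhat : 'I_N -> 'cV[R]_N -> R -> R -> 'cV[R]_N) :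
  hyperbolic_system M K delta0 lam0 A0 A1 B0 lam l r Lamlo Lamhi ->
  generalized_eigensystem M K delta0 eta A0 A1 B0 Lamlo Lamhi mu lhat rhat ->
  `|K * delta0| <= tau / 4 -> `|K * eta| <= tau / 4 ->
  N%:R ^+ 2 * eta <= 1 / 2 ->
  2 * (2 * M + tau) * (N%:R ^+ 2 * eta) <= tau / 2 ->
  forall i w z xi, domain delta0 (w, z) -> - M <= xi <= M ->
  `|mu i w z xi - (lam0 i - xi)| <= tau.
Proof.
move=> hs ge /ler_normlW Kd Ke N2 MN i w z xi wD xiM.
have [Mlo lohi hiM] := hs_range hs i.
have [lo0 hi0] := hs_width hs i.
have := ge_lamhat ge wD xiM i.
have x1 := ge_unit ge wD xiM i.
set lh := dot _ _ => lhb.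
have := rayleigh_near x1 (ge_near_id ge wD) N2 (ge_right ge wD xiM i) (S := 2 * M + tau).
rewrite -/lh => /(_ _)/le_trans/(_ MN) near.
move: Ke lo0 hi0; rewrite ler_norml !ler_distl => Ke lo0 hi0.
have : `|lh - xi| <= 2 * M + tau by rewrite ler_distl; lra.
by move=> /near; rewrite !ler_distl; lra.
Qed.

End Assembly.

Theorem lemma4p12 (R : realType) (N : nat) (M K : R) (lam0 : 'I_N -> R) :
  (forall i j : 'I_N, (i < j)%N -> lam0 i < lam0 j) ->
  exists delta_bar eta_bar : R, [/\ 0 < delta_bar, 0 < eta_bar &
  forall (delta0 eta : R)
    (A0 A1 B0 : 'cV[R]_N -> R -> 'M[R]_N)
    (lam : 'I_N -> 'cV[R]_N -> R -> R)
    (l r : 'I_N -> 'cV[R]_N -> R -> 'cV[R]_N)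
    (Lamlo Lamhi : 'I_N -> R)
    (mu : 'I_N -> 'cV[R]_N -> R -> R -> R)
    (lhat rhat : 'I_N -> 'cV[R]_N -> R -> R -> 'cV[R]_N)
    (c : 'I_N -> R),
  0 < delta0 <= delta_bar ->
  0 < eta <= eta_bar ->
  hyperbolic_system M K delta0 lam0 A0 A1 B0 lam l r Lamlo Lamhi ->
  generalized_eigensystem M K delta0 eta A0 A1 B0 Lamlo Lamhi mu lhat rhat ->
  (forall i, Lamlo i <= c i <= Lamhi i) ->
  exists C : R, forall (eps : R) (u : R -> 'cV[R]_N) (v : R -> R)
    (rho : 'I_N -> R) (psi : R -> R) (i j : 'I_N) (y : R),
  0 < eps ->
  {within `[- M, M], continuous u} ->
  {within `[- M, M], continuous v} ->
  (forall x, x \in `[- M, M] -> domain delta0 (u x, v x)) ->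
  (forall k, - M <= rho k <= M) ->
  (forall k x, x \in `[- M, M] -> 0 <= phase mu u v rho k x) ->
  lebesgue_measure.-integrable `[- M, M] (EFin \o psi) ->
  i != j ->
  y \in `[- M, M] ->
  `|interaction M eps mu u v rho c psi j i y| <=
    C * L1norm M psi *
    (phistar M eps mu u v rho j y + phistar M eps mu u v rho i y)].
Proof.
move=> /increasing_gap[gap gap0 lam0_gap].
pose tau := gap / 16; have tau0 : 0 < tau by rewrite divr_gt0.
have P0 : 0 <= N%:R ^+ 2 :> R by rewrite exprn_ge0.
have S0 : 0 <= 2 * `|M| + tau by rewrite addr_ge0 ?mulr_ge0// ltW.
(* Each smallness condition on delta0 and eta has the form a * t <= m with a one
   summand of D, so t <= m / D implies all of them at once. *)
pose D := `|K| + N%:R ^+ 2 + 4 * (2 * `|M| + tau) * N%:R ^+ 2 + 1.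
pose m := Num.min (1 / 2) (tau / 4).
have m0 : 0 < m by rewrite lt_min !divr_gt0.
have m1 : m <= 1 / 2 by rewrite ge_min lexx.
have m2 : m <= tau / 4 by rewrite ge_min lexx orbT.
have K0 := normr_ge0 K.
have SP0 : 0 <= 4 * (2 * `|M| + tau) * N%:R ^+ 2 by rewrite !mulr_ge0.
have D0 : 0 < D by rewrite /D; lra.
have small t a : 0 <= a -> a <= D -> 0 < t <= m / D -> a * t <= m.
  move=> a0 aD /andP[t0]; rewrite ler_pdivlMr// mulrC.
  by apply: le_trans; rewrite ler_wpM2r// ltW.
exists (m / D), (m / D); split; rewrite ?divr_gt0//.
move=> delta0 eta A0 A1 B0 lam l r Lamlo Lamhi mu lhat rhat c dlt et hs ge cL.
exists (interaction_constant M tau).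
move=> eps u v rho psi i j y eps0 uc vc uvD rhoM phase0 psii ij.
rewrite in_itv/= => yM.
have M0 : 0 < M by have [] := hs_range hs i; lra.
have normM : `|M| = M by rewrite gtr0_norm.
have Kd : `|K * delta0| <= tau / 4.
  rewrite normrM (gtr0_norm (_ : 0 < delta0)); last by case/andP: dlt.
  by apply: le_trans m2; apply: small => //; rewrite /D; lra.
have Ke : `|K * eta| <= tau / 4.
  rewrite normrM (gtr0_norm (_ : 0 < eta)); last by case/andP: et.
  by apply: le_trans m2; apply: small => //; rewrite /D; lra.
have N2 : N%:R ^+ 2 * eta <= 1 / 2.
  by apply: le_trans m1; apply: small => //; rewrite /D; lra.
have MN : 2 * (2 * M + tau) * (N%:R ^+ 2 * eta) <= tau / 2.
  have : 4 * (2 * `|M| + tau) * N%:R ^+ 2 * eta <= m.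
    by apply: small => //; rewrite /D; lra.
  by rewrite normM -mulrA; lra.
have near := eigenvalue_near hs ge Kd Ke N2 MN.
have mu_gap w z xi : domain delta0 (w, z) -> - M <= xi <= M ->
    forall k k' : 'I_N, (k < k')%N -> mu k w z xi + 14 * tau <= mu k' w z xi.
  move=> wD xiM k k' /lam0_gap; have := near k _ _ _ wD xiM; have := near k' _ _ _ wD xiM.
  by rewrite !ler_distl /tau; lra.
have mc k : {within `[- M, M], continuous (fun x => mu k (u x) (v x) x)}.
  apply: (eigenvalue_continuous uc vc uvD (hs_smoothA0 hs) (hs_smoothA1 hs)
    (hs_smoothB0 hs) (hs_unitA0 hs) (hs_unitB0 hs) (ge_right ge) (ge_dual ge) _ mu_gap).
  by rewrite mulr_gt0.
have cM k : - M <= c k <= M.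
  by have := cL k; have [] := hs_range hs k; lra.
have cl k : `|c k - lam0 k| <= tau.
  have [] := hs_width hs k; move: (cL k) Kd; rewrite ler_norml !ler_distl; lra.
have ph0 k x : - M <= x <= M -> 0 <= phase mu u v rho k x.
  by move=> xM; apply: phase0; rewrite in_itv.
have near' k x : - M <= x <= M -> `|mu k (u x) (v x) x - (lam0 k - x)| <= tau.
  by move=> xM; apply: near => //; apply: uvD; rewrite in_itv.
have sep : 16 * tau <= `|lam0 i - lam0 j|.
  have [ltij|ltji|/val_inj eqij] := ltngtP i j; last by rewrite eqij eqxx in ij.
  - have := lam0_gap _ _ ltij; have := ler_norm (lam0 j - lam0 i).
    by rewrite distrC /tau; lra.
  - have := lam0_gap _ _ ltji; have := ler_norm (lam0 i - lam0 j).
    by rewrite /tau; lra.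
exact: (two_wave_interaction_le M0 eps0 tau0 (mc i) (mc j)
  (phase_rate (mc i) (rhoM i)) (phase_rate (mc j) (rhoM j)) (near' i) (near' j)
  (ph0 i) (ph0 j) (rhoM i) (rhoM j) (phase_origin _ _ _ _ _) (phase_origin _ _ _ _ _)
  (cM i) (cM j) (cl i) (cl j) sep psii yM).
Qed.
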